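(* Let $h\geq 4$ and $k\geq 3h+3$ be positive integers. Let $A$ be a finite set of $k$ integers such that $\min(A)=0$, $\gcd(A)=1$, and $|h^{\wedge}A| = hk-h^2+3$. Then $A=[0,k+1]\setminus\{x,y\}$, where $\{x,y\}$ is one of the sets $\{1,2\}$, $\{k-1,k\}$, $\{1,k\}$, $\{2,k+1\}$, $\{k-2,k+1\}$.
   Context: For a finite set $A$ of integers and a positive integer $h\le |A|$, the restricted $h$-fold sumset $h^{\wedge}A$ is the set of all sums of $h$ distinct elements of $A$. For integers $\alpha\le\beta$, $[\alpha,\beta]=\{x\in\mathbb{Z}:\alpha\le x\le\beta\}$. $\gcd(A)$ denotes the greatest common divisor of the elements of $A$. *)

(* Defs.v *)
From mathcomp Require Import all_boot all_order all_algebra.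
From mathcomp Require Import finmap.

Set Implicit Arguments.
Unset Strict Implicit.
Unset Printing Implicit Defensive.

Import Order.TTheory GRing.Theory Num.Theory.

Local Open Scope fset_scope.
Local Open Scope ring_scope.

Definition restricted_sumset (h : nat) (A : {fset int}) : {fset int} :=
  [fset \sum_(b <- (B : {fset int})) b | B in fpowerset A & #|` B| == h].

Definition is_min (A : {fset int}) (m : int) : Prop :=
  m \in A /\ {in A, forall a, m <= a}.

Definition gcd_fset (A : {fset int}) : int := \big[gcdz/0]_(a <- A) a.

(* The filter makes the interval empty when b < a, despite the absolute value
   in the length of the candidate list. *)
Definition int_interval (a b : int) : {fset int} :=
  [fset x in [seq a + n%:Z | n <- iota 0 `|b - a|%N.+1] | x <= b].

Lemma in_restricted_sumset (h : nat) (A : {fset int}) (s : int) :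
  reflect (exists B : {fset int},
             [/\ B `<=` A, #|` B| = h & s = \sum_(b <- B) b])
          (s \in restricted_sumset h A).
Proof.
apply: (iffP (imfsetP _ _ _ _)) => [[B /= ]|[B [sBA cB ->]]].
  by rewrite !inE fpowersetE => /andP[sBA /eqP cB] ->; exists B.
by exists B; rewrite //= !inE fpowersetE sBA cB eqxx.
Qed.

Lemma in_int_interval (a b x : int) :
  (x \in int_interval a b) = (a <= x <= b).
Proof.
rewrite [LHS]in_fset.
transitivity ((x \in [seq a + n%:Z | n <- iota 0 `|b - a|%N.+1]) && (x <= b)) => //.
case: (leP x b) => xb; rewrite ?andbT ?andbF //.
apply/mapP/idP => [[n _ ->]|ax]; first by rewrite lerDl.
have xaE : `|x - a|%N%:Z = x - a by rewrite gez0_abs // subr_ge0.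
exists `|x - a|%N; last by rewrite xaE addrC subrK.
rewrite mem_iota /= add0n ltnS -lez_nat xaE gez0_abs ?lerB //.
by rewrite subr_ge0 (le_trans ax).
Qed.

(* Main.v *)
Require Import Defs.
From mathcomp Require Import all_boot all_order all_algebra.
From mathcomp Require Import finmap.
From mathcomp Require Import zify ring.

Set Implicit Arguments.
Unset Strict Implicit.
Unset Printing Implicit Defensive.

Import Order.TTheory GRing.Theory Num.Theory.

Local Open Scope fset_scope.
Local Open Scope ring_scope.

(* Write A = {a_0 < ... < a_(k-1)} and w = k - h. Call |h^A| - (h w + 1) the
   excess. Fixing the lowest or the highest terms of an h-subset shows that the
   excess of A is at least the sum of the excesses of the 2-fold sumsets of the
   windows a_l, ..., a_(l+w+1) and a_(l+2), ..., a_(l+w+3). For 2-fold sums, two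
   different gaps a_(p+1) - a_p and a_(q+1) - a_q with p + 2 <= q give two
   different values between a_p + a_q and a_(p+1) + a_(q+1), hence one unit of
   excess. As the total excess is 2, all gaps except the first two and the last
   two equal some d; the four other ones are bounded multiples of d, as otherwise
   some translates within a 2-fold sumset would be disjoint. Hence d = 1 and the
   h-fold sumset is an interval, whose length gives
   e + 2 f + 2 m + g = 8 for the first two gaps e, f and the last two m, g. *)

(** * Sums of distinct terms of an increasing sequence *)

Definition rsum (a : nat -> int) (j l m : nat) : {fset int} :=
  restricted_sumset j [fset a i | i in iota l m].

Definition increasing (a : nat -> int) := forall i j : nat, (i < j)%N -> a i < a j.

Lemma increasing_inj a : increasing a -> injective a.
Proof.
move=> inc i j eqa; case: (ltngtP i j) => // /inc; by rewrite eqa ltxx.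
Qed.

(** Injectivity of [a] lets subsets of a window be replaced by strictly increasing index lists,
    which can be concatenated and compared term by term. *)
Lemma rsumP a j l m x : increasing a ->
  x \in rsum a j l m <->
  exists s : seq nat, [/\ sorted ltn s, size s = j, {subset s <= iota l m}
                        & x = \sum_(i <- s) a i].
Proof.
move=> inc; have inj := increasing_inj inc; split.
- case/in_restricted_sumset=> B [sBA cB ->].
  have pB : perm_eq [seq a i | i <- iota l m & a i \in B] B.
    apply: uniq_perm; rewrite ?fset_uniq //.
      by rewrite map_inj_uniq // filter_uniq // iota_uniq.
    move=> y; apply/mapP/idP => [[i]|yB].
      by rewrite mem_filter => /andP[aB _] ->.
    have /imfsetP[i /= il ya] := fsubsetP sBA _ yB.
    by exists i; rewrite // mem_filter -ya yB.
  exists [seq i <- iota l m | a i \in B]; split.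
  + by apply: sorted_filter; [exact: ltn_trans | exact: iota_ltn_sorted].
  + by rewrite -(size_map a) (perm_size pB).
  + by move=> i; rewrite mem_filter => /andP[].
  + by rewrite -(big_map a predT id) (perm_big _ pB).
- case=> s [srt szs sub ->]; apply/in_restricted_sumset.
  have us : uniq s := sorted_uniq ltn_trans ltnn srt.
  have pB : perm_eq [fset a i | i in s] [seq a i | i <- s].
    apply: uniq_perm; rewrite ?fset_uniq ?map_inj_uniq //.
    move=> y; apply/imfsetP/mapP => [[i /= si ->]|[i si ->]]; by exists i.
  exists [fset a i | i in s]; split.
  + by apply/fsubsetP=> y /imfsetP[i /= si ->]; apply/imfsetP; exists i; rewrite //= sub.
  + by rewrite (perm_size pB) size_map.
  + by rewrite (perm_big _ pB) big_map.
Qed.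

Lemma sum_iota_le a l s : increasing a -> sorted ltn s -> all (leq l) s ->
  \sum_(i <- iota l (size s)) a i <= \sum_(i <- s) a i.
Proof.
move=> inc; elim: s l => [|x s IHs] l /= srt; first by rewrite !big_nil.
case/andP=> lx _; rewrite !big_cons; apply: lerD.
  by move: lx; rewrite leq_eqVlt => /predU1P[->|/inc/ltW].
apply: IHs; first exact: path_sorted srt.
apply/allP=> y ys; have /allP/(_ y ys) := order_path_min ltn_trans srt.
exact: leq_ltn_trans.
Qed.

Lemma sum_le_iota a l s : increasing a -> sorted ltn s ->
  all (fun i => i < l + size s)%N s ->
  \sum_(i <- s) a i <= \sum_(i <- iota l (size s)) a i.
Proof.
move=> inc; elim/last_ind: s => [|s x IHs] srt; first by rewrite !big_nil.
rewrite all_rcons size_rcons addnS ltnS => /andP[xl _].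
rewrite -[in iota _ _]addn1 iotaD -cats1 !big_cat !big_seq1 /=; apply: lerD.
  have srts : sorted ltn s.
    by apply: subseq_sorted srt; [exact: ltn_trans | exact: subseq_rcons].
  apply: IHs => //; apply/allP=> y ys; apply: leq_trans xl.
  have : sorted ltn (s ++ [:: x]) by rewrite cats1.
  rewrite sorted_pairwise; last exact: ltn_trans.
  by rewrite pairwise_cat => /and3P[/allrelP/(_ y x ys (mem_head _ _))].
by move: xl; rewrite leq_eqVlt => /predU1P[->|/inc/ltW].
Qed.

Lemma rsum_ge a j l m x : increasing a -> x \in rsum a j l m ->
  \sum_(i <- iota l j) a i <= x.
Proof.
move=> inc /(rsumP _ _ _ _ inc)[s [srt <- sub ->]].
by apply: sum_iota_le => //; apply/allP=> i /sub; rewrite mem_iota => /andP[].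
Qed.

Lemma rsum_le a j l w x : increasing a -> x \in rsum a j l (w + j) ->
  x <= \sum_(i <- iota (l + w) j) a i.
Proof.
move=> inc /(rsumP _ _ _ _ inc)[s [srt <- sub ->]].
apply: sum_le_iota => //; apply/allP=> i /sub; rewrite mem_iota -addnA.
by case/andP.
Qed.

(** * Lower bounds from splitting off extreme terms *)

Lemma card_shift (c : int) (X : {fset int}) : #|` [fset c + x | x in X]| = #|` X|.
Proof. by apply: card_imfset => x y /addrI. Qed.

(* The sums on both sides lie on either side of the sum of the lowest [i] and
   the highest [j] terms, which is the only value that they can share. *)
Lemma card_rsum_split a i j l w : increasing a ->
  (#|` rsum a i l (w + i)| + #|` rsum a j (l + i) (w + j)|
    <= (#|` rsum a (i + j) l (w + (i + j))|).+1)%N.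
Proof.
move=> inc.
set lo := \sum_(t <- iota l i) a t.
set hi := \sum_(t <- iota (l + i + w) j) a t.
rewrite -(card_shift hi (rsum a i _ _)) -(card_shift lo (rsum a j _ _)).
set X := [fset _ | _ in _]; set Y := [fset _ | _ in _].
rewrite -cardfsUI -addn1; apply: leq_add.
  apply/fsubset_leq_card/fsubsetP=> z; rewrite inE.
  case/orP=> /imfsetP[x /= /(rsumP _ _ _ _ inc)[s [srt szs sub ->]] ->].
    apply/rsumP=> //; exists (s ++ iota (l + i + w) j).
    rewrite size_cat size_iota szs big_cat /= addrC; split=> //.
      rewrite sorted_pairwise; last exact: ltn_trans.
      rewrite pairwise_cat -!(sorted_pairwise ltn_trans) srt iota_ltn_sorted !andbT.
      by apply/allrelP=> y t /sub; rewrite !mem_iota; lia.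
    by move=> t; rewrite mem_cat => /orP[/sub|]; rewrite !mem_iota; lia.
  apply/rsumP=> //; exists (iota l i ++ s).
  rewrite size_cat size_iota szs big_cat /=; split=> //.
    rewrite sorted_pairwise; last exact: ltn_trans.
    rewrite pairwise_cat -!(sorted_pairwise ltn_trans) srt iota_ltn_sorted !andbT.
    by apply/allrelP=> y t + /sub; rewrite !mem_iota; lia.
  by move=> t; rewrite mem_cat => /orP[|/sub]; rewrite !mem_iota; lia.
rewrite -(cardfs1 (lo + hi)); apply/fsubset_leq_card/fsubsetP=> z.
rewrite !inE => /andP[/imfsetP[x /= /(rsum_ge inc) xlo ->]].
case/imfsetP=> y /= /(rsum_le inc); rewrite -/hi => yhi eqz.
by rewrite /lo in eqz xlo *; apply/eqP; lia.
Qed.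

Lemma card_rsum1 a l m : increasing a -> #|` rsum a 1 l m| = m.
Proof.
move=> inc.
have -> : rsum a 1 l m = [fset a i | i in iota l m].
  apply/fsetP=> x; apply/idP/imfsetP => [|[i /= im ->]].
    case/(rsumP _ _ _ _ inc)=> s [_]; case: s => [|i [|]] //= _ sub ->; exists i.
      by rewrite /= sub ?mem_head.
    by rewrite big_seq1.
  apply/rsumP=> //; exists [:: i]; split; rewrite ?big_seq1 //.
  by move=> ?; rewrite inE => /eqP->.
rewrite card_imfset /=; last exact: increasing_inj.
by rewrite undup_id ?iota_uniq // size_iota.
Qed.

(** Splitting off one term at a time: a single term ranges over [w + 1] values, one of which is lost
    to the shared sum, so each term contributes [w]. *)
Lemma card_rsum_ge a j l w : increasing a ->
  (j * w < #|` rsum a j l (w + j)|)%N.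
Proof.
move=> inc; elim: j l => [|j IHj] l.
  rewrite mul0n; apply: (@leq_trans #|` [fset (0 : int)]|); first by rewrite cardfs1.
  apply/fsubset_leq_card/fsubsetP=> x; rewrite inE => /eqP->.
  by apply/rsumP=> //; exists [::]; rewrite big_nil.
have := card_rsum_split 1 j l w inc; have := IHj (l + 1)%N.
by rewrite card_rsum1 // add1n; nia.
Qed.

(** The [h] terms are split into blocks of [l], 2, 2 and [r] terms. Three splittings lose one each,
    while the outer blocks have at least [l * w + 1] and [r * w + 1] sums; this leaves the single
    successor on the right. *)
Lemma card_rsum2_pair a h l w : increasing a -> (l + 4 <= h)%N ->
  (#|` rsum a 2 l (w + 2)| + #|` rsum a 2 (l + 2) (w + 2)| + (h - 4) * w
    <= (#|` rsum a h 0 (w + h)|).+1)%N.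
Proof.
move=> inc lh; set r := (h - 4 - l)%N.
have -> : h = (l + (2 + (2 + r)))%N by rewrite /r; lia.
have := card_rsum_split l (2 + (2 + r)) 0 w inc.
have := card_rsum_split 2 (2 + r) l w inc.
have := card_rsum_split 2 r (l + 2) w inc.
have := card_rsum_ge l 0 w inc; have := card_rsum_ge r (l + 2 + 2) w inc.
rewrite add0n; set s1 := #|` _|; set s2 := #|` _|; set s3 := #|` _|.
set s4 := #|` _|; set s5 := #|` _|; set s6 := #|` _|; set s7 := #|` _|;
have -> : ((l + (2 + (2 + r)) - 4) * w = l * w + r * w)%N by nia.
lia.
Qed.

(** * Unequal gaps enlarge 2-fold sumsets *)

Lemma card_le_lt (S : {fset int}) (x y : int) : x < y -> y \in S ->
  (#|` [fset z in S | (z <= x)%R]| < #|` [fset z in S | (z <= y)%R]|)%N.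
Proof.
move=> xy yS; apply/fproper_ltn_card; rewrite fproperE; apply/andP; split.
  by apply/fsubsetP=> z; rewrite !inE => /andP[-> zx] /=; rewrite (le_trans zx) // ltW.
by apply/fsubsetPn; exists y; rewrite !inE yS /= ?lexx // -ltNge.
Qed.

(* [excess p q] is the number of elements of [S] up to [a p + a q], minus the
   number of steps from [a 0 + a 1] to it when one index at a time grows by 1. *)
Lemma excess2 a (S : {fset int}) n : increasing a -> (2 <= n)%N ->
    (forall i j, (i < j < n)%N -> a i + a j \in S) ->
  exists excess : nat -> nat -> nat,
  [/\ forall p q p' q', (p < q)%N -> (p' < q' < n)%N -> (p <= p')%N -> (q <= q')%N ->
        (excess p q <= excess p' q')%N,
      forall p q, (p + 2 <= q)%N -> (q.+1 < n)%N ->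
        a p.+1 - a p != a q.+1 - a q ->
        (excess p q < excess p.+1 q.+1)%N &
      (forall p q, (p < q < n)%N -> excess p q + (2 * n - 3) <= #|` S|)%N].
Proof.
move=> inc n2 aS.
pose G p q := #|` [fset z in S | (z <= a p + a q)%R]|.
have Gq p q d : (p < q)%N -> (q + d < n)%N -> (G p q + d <= G p (q + d))%N.
  move=> pq; elim: d => [|d IHd] qd; first by rewrite !addn0.
  rewrite !addnS; apply: leq_ltn_trans (IHd _) _; first by lia.
  apply: card_le_lt; first by have := inc (q + d)%N (q + d).+1 (leqnn _); lia.
  by apply: aS; lia.
have Gp p q d : (p + d < q)%N -> (q < n)%N -> (G p q + d <= G (p + d) q)%N.
  move=> + qn; elim: d => [|d IHd] pd; first by rewrite !addn0.
  rewrite !addnS; apply: leq_ltn_trans (IHd _) _; first by lia.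
  apply: card_le_lt; first by have := inc (p + d)%N (p + d).+1 (leqnn _); lia.
  by apply: aS; lia.
have Gpq p q p' q' : (p < q)%N -> (p' < q' < n)%N -> (p <= p')%N -> (q <= q')%N ->
    (G p q + (p' - p) + (q' - q) <= G p' q')%N.
  move=> pq /andP[pq' qn] pp qq.
  have := Gq p q (q' - q)%N pq; have := Gp p q' (p' - p)%N; rewrite !subnKC //; lia.
have G01 : (0 < G 0%N 1%N)%N.
  by rewrite cardfs_gt0; apply/fset0Pn; exists (a 0%N + a 1%N); rewrite !inE lexx andbT aS.
have Gge p q : (p < q < n)%N -> (p + q <= G p q)%N.
  move=> pq; have := Gpq 0%N 1%N p q; lia.
(* A path of unit steps from (0, 1) to (p, q) meets [p + q] increasing sums, both ends included; by
   [Gge] the subtraction is never truncated. *)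
exists (fun p q => G p q - (p + q))%N; split.
- by move=> p q p' q' *; have := Gpq p q p' q'; have := Gge p q; lia.
- move=> p q pq qn neq.
  suff : (G p q + 3 <= G p.+1 q.+1)%N by have := Gge p q; lia.
  have ip := inc p p.+1 (leqnn _); have iq := inc q q.+1 (leqnn _).
  have s1 : a p.+1 + a q \in S by apply: aS; lia.
  have s2 : a p + a q.+1 \in S by apply: aS; lia.
  have s3 : a p.+1 + a q.+1 \in S by apply: aS; lia.
  (* Since the gaps differ, both ways around the square of index pairs give distinct intermediate
     sums: three new elements for two steps. *)
  have [lt|gt] : a p.+1 + a q < a p + a q.+1 \/ a p + a q.+1 < a p.+1 + a q.
    by move/eqP: neq; lia.
  + have := @card_le_lt S (a p + a q) _ _ s1; have := @card_le_lt S _ _ lt s2.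
    by have := @card_le_lt S (a p + a q.+1) _ _ s3; rewrite /G; lia.
  + have := @card_le_lt S (a p + a q) _ _ s2; have := @card_le_lt S _ _ gt s1.
    by have := @card_le_lt S (a p.+1 + a q) _ _ s3; rewrite /G; lia.
- move=> p q pq; have := Gpq p q (n - 2)%N (n - 1)%N; have := Gge p q.
  have : (G (n - 2) (n - 1) <= #|` S|)%N.
    by apply/fsubset_leq_card/fsubsetP=> z; rewrite !inE => /andP[].
  lia.
Qed.

(** The gaps [i] and [i + 1] are too close to be compared with each other by [excess2]. A third gap,
    [i - 2] or [i + 3], is at distance at least 2 from both and differs from one of them. *)
Lemma card_sum2_gap a (S : {fset int}) n i : increasing a -> (6 <= n)%N ->
    (forall i j, (i < j < n)%N -> a i + a j \in S) ->
  (i + 3 <= n)%N -> a i.+1 - a i != a i.+2 - a i.+1 ->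
  (2 * n - 2 <= #|` S|)%N.
Proof.
move=> inc n6 aS i3 neq.
have [//|H [Hmon Hd Hn]] := excess2 inc _ aS; first by lia.
suff [p [q [pq qn Hpq]]] : exists p q, [/\ (p < q)%N, (q < n)%N & (0 < H p q)%N].
  by have := Hn p q; lia.
have diamond p q : (p + 2 <= q)%N -> (q.+1 < n)%N -> a p.+1 - a p != a q.+1 - a q ->
    exists p q, [/\ (p < q)%N, (q < n)%N & (0 < H p q)%N].
  move=> pq qn /(Hd _ _ pq qn) Hpq; exists p.+1, q.+1; split; lia.
have [i1|i1] := leqP 2 i.
  have [eq1|] := eqVneq (a (i - 2).+1 - a (i - 2)%N) (a i.+1 - a i); last by apply: diamond; lia.
  by apply: (diamond (i - 2)%N i.+1); [lia|lia|rewrite eq1].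
have [eq1|] := eqVneq (a i.+1 - a i) (a (i + 3).+1 - a (i + 3)%N); last by apply: diamond; lia.
by apply: (diamond i.+1 (i + 3)%N); [lia|lia|rewrite -eq1 eq_sym].
Qed.

(** Here both [i - 2] and [i + 3] are available as third gap, and the two units of excess that they
    yield occur one after the other. *)
Lemma card_sum2_inner_gap a (S : {fset int}) n i : increasing a ->
    (forall i j, (i < j < n)%N -> a i + a j \in S) ->
  (2 <= i)%N -> (i + 5 <= n)%N -> a i.+1 - a i != a i.+2 - a i.+1 ->
  (2 * n - 1 <= #|` S|)%N.
Proof.
move=> inc aS i2 i5 neq.
have [//|H [Hmon Hd Hn]] := excess2 inc _ aS; first by lia.
have [p [p1 p2 p3]] : exists p, [/\ (i <= p)%N, (p <= i.+1)%N &
    (H (i - 2) p < H (i - 2).+1 p.+1)%N].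
  have [eq1|neq1] := eqVneq (a (i - 2).+1 - a (i - 2)%N) (a i.+1 - a i).
    by exists i.+1; split=> //; apply: Hd; [lia|lia|rewrite eq1].
  by exists i; split=> //; apply: Hd => //; lia.
have [q [q1 q2 q3]] : exists q, [/\ (i <= q)%N, (q <= i.+1)%N &
    (H q (i + 3) < H q.+1 (i + 3).+1)%N].
  have [eq1|neq1] := eqVneq (a i.+1 - a i) (a (i + 3).+1 - a (i + 3)%N).
    by exists i.+1; split=> //; apply: Hd; [lia|lia|rewrite -eq1 eq_sym].
  by exists i; split=> //; apply: Hd => //; lia.
(* The first rise ends at [(i - 1, p + 1)], below the start [(q, i + 3)] of the second one, so
   monotonicity adds them up. *)
have := Hmon (i - 2).+1 p.+1 q (i + 3)%N; have := Hn q.+1 (i + 3).+1; lia.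
Qed.

Lemma rsum2_mem a l w i j : increasing a -> (i < j < w)%N ->
  a (l + i)%N + a (l + j)%N \in rsum a 2 l w.
Proof.
move=> inc ij; apply/rsumP=> //; exists [:: (l + i)%N; (l + j)%N].
rewrite !big_cons big_nil addr0 /= andbT; split=> //; first by lia.
by move=> t; rewrite !inE mem_iota; lia.
Qed.

(** Two windows shifted by 2 have total excess at most 2. If the two gaps differ, a window with both
    of them well inside has excess at least 2, and a window merely containing them has excess at
    least 1. So it suffices to find a pair with one window of the first kind and the other of the
    second. *)
Lemma rsum_equal_gaps a h w i : increasing a -> (4 <= h)%N -> (2 * h + 3 <= w)%N ->
  (#|` rsum a h 0 (w + h)| <= h * w + 3)%N ->
  (2 <= i)%N -> (i + 5 <= w + h)%N -> a i.+1 - a i = a i.+2 - a i.+1.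
Proof.
move=> inc h4 hw card_le i2 ih; apply/eqP; apply: contraT => neq.
have pair l : (l + 4 <= h)%N ->
    (#|` rsum a 2 l (w + 2)| + #|` rsum a 2 (l + 2) (w + 2)| <= 4 * w + 4)%N.
  by move/(card_rsum2_pair w inc); nia.
have incl l : increasing (fun t => a (l + t)%N) by move=> s t st; apply: inc; lia.
have memS l s t : (s < t < w + 2)%N -> a (l + s)%N + a (l + t)%N \in rsum a 2 l (w + 2).
  exact: rsum2_mem.
have outer l : (l <= i)%N -> (i + 1 <= l + w)%N ->
    (2 * w + 2 <= #|` rsum a 2 l (w + 2)|)%N.
  move=> li il; have := @card_sum2_gap _ _ (w + 2) (i - l) (incl l) _ (memS l).
  rewrite !addnS !subnKC //; move: neq => /[swap] /[apply]; lia.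
have inner l : (l + 2 <= i)%N -> (i + 3 <= l + w)%N ->
    (2 * w + 3 <= #|` rsum a 2 l (w + 2)|)%N.
  move=> li il; have := @card_sum2_inner_gap _ _ (w + 2) (i - l) (incl l) (memS l).
  rewrite !addnS !subnKC; last by lia.
  by move: neq => /[swap]; do 2!(move=> /(_ ltac:(lia))); move=> /[apply]; lia.
(* Away from the top, the lower window has the gaps well inside; truncation makes it start at 0 when
   [i] is small. Near the top, the upper window of the last pair does. *)
have [ik|ik] := leqP (i + 7) (w + h).
  have := pair (i + 3 - w)%N; have := inner (i + 3 - w)%N.
  have := outer (i + 3 - w + 2)%N; lia.
have := pair (h - 4)%N; have := inner (h - 2)%N; have := outer (h - 4)%N.
have -> : (h - 4 + 2 = h - 2)%N by lia.
lia.
Qed.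

(** * Arithmetic structure of the gaps *)

Definition progression (c d : int) (m : nat) : {fset int} :=
  [fset c + d * t%:Z | t in iota 0 m].

Lemma progressionP c d m x :
  reflect (exists2 t : nat, (t < m)%N & x = c + d * t%:Z) (x \in progression c d m).
Proof.
by apply: (iffP (imfsetP _ _ _ _)) => -[t /=]; rewrite ?mem_iota ?add0n => tm ->;
  exists t; rewrite //= mem_iota.
Qed.

Lemma card_progression c d m : d != 0 -> #|` progression c d m| = m.
Proof.
move=> d0; rewrite card_imfset /=; first by rewrite undup_id ?iota_uniq // size_iota.
by move=> s t /addrI/(mulfI d0) [].
Qed.

(* If a gap were not as claimed, then two of the progressions [b 0 + b j],
   [b 1 + b j], [b i + b j] with [2 <= i < j] would be disjoint. *)
Lemma card_sum2_end_gaps (b : nat -> int) (S : {fset int}) (n : nat) (d : int) :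
    (9 <= n)%N -> (forall i j, (i < j < n)%N -> b i < b j) ->
    (forall i j, (i < j < n)%N -> b i + b j \in S) ->
    (forall t, (t + 2 < n)%N -> b (t + 2)%N = b 2%N + d * t%:Z) ->
    (#|` S| <= 2 * n - 1)%N ->
  exists e f : nat, [/\ b 1%N - b 0%N = d * e%:Z, b 2%N - b 1%N = d * f%:Z,
                        (e + 3 <= n)%N & (f + 4 <= n)%N].
Proof.
move=> n9 inc memS lin cardS.
have b01 : b 0%N < b 1%N by apply: inc; lia.
have b12 : b 1%N < b 2%N by apply: inc; lia.
have d0 : 0 < d.
  have := lin 1%N; have := inc 2%N 3%N; rewrite add1n; lia.
have dn0 : d != 0 by rewrite gt_eqF.
pose P := progression (b 0%N + b 2%N) d (n - 2).
pose Q := progression (b 1%N + b 2%N) d (n - 2).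
(* The [n - 2] terms from [b 2] on form a progression, so their 2-fold sums are [2 * (n - 2) - 3]
   consecutive multiples of [d] above the least one, [b 2 + b 3]. *)
pose R := progression (b 2%N + b 2%N + d) d (2 * n - 7).
have PS : P `<=` S.
  apply/fsubsetP=> x /progressionP[t tn ->].
  by rewrite -addrA -lin; [apply: memS|]; lia.
have QS : Q `<=` S.
  apply/fsubsetP=> x /progressionP[t tn ->].
  by rewrite -addrA -lin; [apply: memS|]; lia.
have RS : R `<=` S.
  apply/fsubsetP=> x /progressionP[t tn ->].
  have [tn3|tn3] := leqP (t + 4) n.
    have -> : b 2%N + b 2%N + d + d * t%:Z = b 2%N + b (t.+1 + 2)%N.
      by rewrite lin; [nia|lia].
    by apply: memS; lia.
  have -> : b 2%N + b 2%N + d + d * t%:Z = b ((t + 4 - n) + 2)%N + b ((n - 3) + 2)%N.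
    rewrite !lin; [|lia|lia].
    have -> : t%:Z = (t + 4 - n)%N%:Z + (n - 3)%N%:Z - 1 by lia.
    by ring.
  by apply: memS; lia.
have [e be en] : exists2 e : nat, b 1%N - b 0%N = d * e%:Z & (e + 3 <= n)%N.
  have [PQ0|/fset0Pn[x]] := eqVneq (P `&` Q) fset0; last first.
    rewrite inE => /andP[/progressionP[s sn xs] /progressionP[t tn xt]].
    have st : (t < s)%N by nia.
    exists (s - t)%N; last by lia.
    by rewrite -subzn; [lia|lia].
  (* The sums of [b (n - 1)] with [b 2], ..., [b (n - 2)] exceed everything in [P] and [Q]. If those
     two were disjoint, [S] would have at least [3 * n - 7] elements. *)
  pose R' := progression (b 2%N + b (n - 3 + 2)%N) d (n - 3).
  have R'S : R' `<=` S.
    apply/fsubsetP=> x /progressionP[t tn ->].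
    by rewrite addrAC -lin; [apply: memS|]; lia.
  have PQS : (P `|` Q) `|` R' `<=` S by rewrite !fsubUset PS QS.
  have := fsubset_leq_card PQS; have := cardfsUI (P `|` Q) R'.
  have := cardfsUI P Q; rewrite PQ0 cardfs0 !card_progression //.
  suff -> : (P `|` Q) `&` R' = fset0 by rewrite cardfs0; lia.
  apply/eqP; apply: contraT => /fset0Pn[x].
  rewrite !inE => /andP[/orP[]/progressionP[s sn ->]] /progressionP[t tn];
    rewrite lin; nia.
exists e; have [QR0|/fset0Pn[x]] := eqVneq (Q `&` R) fset0; last first.
  rewrite inE => /andP[/progressionP[s sn xs] /progressionP[t tn xt]].
  have st : (t.+1 < s)%N by nia.
  exists (s - t.+1)%N; split=> //; last by lia.
  by rewrite -subzn; [nia|lia].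
(* Disjointness would give [3 * n - 9] elements, more than [2 * n - 1] precisely because
   [9 <= n]. *)
have QRS : Q `|` R `<=` S by rewrite !fsubUset QS.
have := fsubset_leq_card QRS; have := cardfsUI Q R.
rewrite QR0 cardfs0 !card_progression //; lia.
Qed.

(** A window of the first or of the last pair has at most [2 * w + 3] sums, as its partner has at
    least [2 * w + 1]. With [n = w + 2], this is the bound under which [card_sum2_end_gaps] controls
    the end gaps. *)
Lemma rsum_small_structure a h w : increasing a -> (4 <= h)%N -> (2 * h + 3 <= w)%N ->
  (#|` rsum a h 0 (w + h)| <= h * w + 3)%N ->
  exists (d : int) (e f m g : nat),
  [/\ 0 < d,
      forall t, (t + 5 <= w + h)%N -> a (t + 2)%N = a 2%N + d * t%:Z,
      [/\ a 1%N - a 0%N = d * e%:Z, a 2%N - a 1%N = d * f%:Z,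
          a (w + h - 2)%N - a (w + h - 3)%N = d * m%:Z &
          a (w + h - 1)%N - a (w + h - 2)%N = d * g%:Z],
      (e < w)%N /\ (f + 2 <= w)%N & (g < w)%N /\ (m + 2 <= w)%N].
Proof.
move=> inc h4 hw card_le.
have pair l : (l + 4 <= h)%N ->
    (#|` rsum a 2 l (w + 2)| + #|` rsum a 2 (l + 2) (w + 2)| <= 4 * w + 4)%N.
  by move/(card_rsum2_pair w inc); nia.
have card2 l := card_rsum_ge 2 l w inc.
pose d := a 3%N - a 2%N.
have d0 : 0 < d by rewrite subr_gt0; apply: inc.
have lin t : (t + 5 <= w + h)%N -> a (t + 2)%N = a 2%N + d * t%:Z.
  suff gap s : (s + 6 <= w + h)%N -> a (s + 3)%N - a (s + 2)%N = d.
    elim: t => [|t IHt] th; first by rewrite mulr0 addr0.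
    by have := gap t; have := IHt; rewrite addSn -!addnS; nia.
  elim: s => [//|s IHs] sh.
  have := @rsum_equal_gaps a h w (s + 2) inc h4 hw card_le.
  by have := IHs; rewrite !addSn -!addnS; lia.
have [] := @card_sum2_end_gaps a (rsum a 2 0 (w + 2)) (w + 2) d.
- by lia.
- by move=> i j /andP[ij _]; apply: inc.
- by move=> i j; apply: (@rsum2_mem a 0).
- by move=> t tw; apply: lin; lia.
- by have := pair 0%N; have := card2 2%N; rewrite !add0n; lia.
move=> e [f [ae af ew fw]].
(* Reversal and negation turn the top window into a bottom one, so the same lemma yields the last
   two gaps. *)
pose b t := - a (w + h - 1 - t)%N.
have [] := @card_sum2_end_gaps b [fset - x | x in rsum a 2 (h - 2) (w + 2)] (w + 2) d.
- by lia.
- by move=> i j ij; rewrite /b ltrN2; apply: inc; lia.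
- move=> i j ij; apply/imfsetP; exists (a (w + h - 1 - j)%N + a (w + h - 1 - i)%N).
    have -> : (w + h - 1 - i = h - 2 + (w + 1 - i))%N by lia.
    have -> : (w + h - 1 - j = h - 2 + (w + 1 - j))%N by lia.
    by apply: rsum2_mem => //; lia.
  by rewrite /b opprD addrC.
- move=> t tw; rewrite /b.
  have -> : (w + h - 1 - (t + 2) = (w + h - 5 - t) + 2)%N by lia.
  have -> : (w + h - 1 - 2 = (w + h - 5) + 2)%N by lia.
  rewrite !lin; [|lia|lia].
  have -> : (w + h - 5)%N%:Z = (w + h - 5 - t)%N%:Z + t%:Z by lia.
  by ring.
- apply: leq_trans (_ : #|` rsum a 2 (h - 2) (w + 2)| <= _)%N.
    by rewrite card_imfset //; exact: oppr_inj.
  have := pair (h - 4)%N; have := card2 (h - 4)%N.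
  have -> : (h - 4 + 2 = h - 2)%N by lia.
  by lia.
move=> g [m [bg bm gw mw]]; exists d, e, f, m, g; split=> //; [|lia|lia].
have e2 : (w + h - 1 - 1 = w + h - 2)%N by lia.
have e3 : (w + h - 1 - 2 = w + h - 3)%N by lia.
by split=> //; [rewrite -bm|rewrite -bg]; rewrite /b ?subn0 ?e2 ?e3; lia.
Qed.

(** * Sumsets that fill an interval *)

Lemma sum_of_distinct_lt j m v : (j * j <= 2 * v + j)%N ->
  (2 * v + j * j + j <= 2 * (j * m))%N ->
  exists s, [/\ sorted ltn s, size s = j, all (gtn m) s & \sum_(i <- s) i = v].
Proof.
elim: m j v => [|m IHm] j v lo hi.
  have j0 : j = 0%N by nia.
  by exists [::]; rewrite big_nil j0; split=> //; lia.
(* Greedy choice: the largest candidate [m] is taken only if the [j] largest numbers below [m] have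
   a sum less than [v]. *)
have [le|lt] := leqP (2 * v + j * j + j) (2 * (j * m)).
  have [s [srt szs bs vs]] := IHm _ _ lo le; exists s; split=> //.
  by apply: sub_all bs => i /=; lia.
case: j lo hi lt => [|j] lo hi lt; first by lia.
have jm : (j <= m)%N by nia.
have jj : (j * j <= j * m)%N by rewrite leq_mul2l jm orbT.
(* Both sides of [lt] are even, so the strict inequality has slack 2; [lo'] relies on this when
   [j < m]. *)
have par : odd (j * j) = odd j by rewrite oddM andbb.
move: lo hi lt; rewrite !(mulSn, mulnS) => lo hi lt.
have lo' : (j * j + 2 * m <= 2 * v + j)%N.
  have [->|jm'] := eqVneq m j; first by lia.
  have : (j * j + j <= j * m)%N by rewrite addnC -mulnS leq_mul2l; lia.
  lia.
have mv : (m <= v)%N.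
  have : (j <= j * j)%N by case: (j) => // i; rewrite mulSn; lia.
  by lia.
have [||s [srt szs bs vs]] := IHm j (v - m)%N; [lia|lia|].
exists (rcons s m); rewrite size_rcons szs; split=> //.
- rewrite -cats1 sorted_pairwise; last exact: ltn_trans.
  rewrite pairwise_cat -!(sorted_pairwise ltn_trans) srt andbT.
  by apply/allrelP=> x y /(allP bs) /= ? /[!inE] /eqP->.
- by rewrite all_rcons /= ltnSn; apply: sub_all bs => i /=; lia.
- by rewrite -cats1 big_cat big_seq1 /= vs; lia.
Qed.

Lemma sum_of_middle_terms (a : nat -> int) (c : int) M j (v : int) :
    (forall t, (t < M)%N -> a (t + 2)%N = c + t%:Z) ->
    (j * j)%:Z <= 2 * v + j%:Z -> 2 * v + (j * j + j)%:Z <= 2 * (j * M)%:Z ->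
  exists s, [/\ sorted ltn s, size s = j, {subset s <= iota 2 M} &
                \sum_(i <- s) a i = j%:Z * c + v].
Proof.
move=> lin lo hi; have [n vn] : exists n : nat, v = n%:Z.
  exists `|v|%N; have : (j <= j * j)%N by case: (j) => // i; rewrite mulSn; lia.
  by lia.
have [||s [srt szs bs vs]] := @sum_of_distinct_lt j M n; [lia|lia|].
exists [seq (i + 2)%N | i <- s]; rewrite size_map szs; split=> //.
- by rewrite sorted_map; apply: sub_sorted srt => x y /=; lia.
- by move=> _ /mapP[i si ->]; rewrite mem_iota; have /= := allP bs i si; lia.
- rewrite big_map vn -vs -szs; elim: s bs {srt szs vs} => [|x s IHs] /=.
    by rewrite !big_nil mul0r.
  by case/andP=> xM /IHs; rewrite !big_cons lin // => ->; rewrite intS; ring.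
Qed.

(** Doubling avoids dividing in the triangular number j(j - 1)/2. *)
Lemma sum_iota_middle (a : nat -> int) (c : int) M u j :
    (forall t, (t < M)%N -> a (t + 2)%N = c + t%:Z) -> (u + j <= M)%N ->
  2 * \sum_(i <- iota (u + 2) j) a i + j%:Z
    = 2 * (j%:Z * c) + (2 * (j * u) + j * j)%N%:Z.
Proof.
move=> lin; elim: j u => [|j IHj] u uM; first by rewrite big_nil; lia.
rewrite /= big_cons lin; last lia.
have := IHj u.+1; rewrite !addSn => /(_ ltac:(lia)); set S := \sum_(i <- _) _ => E.
have -> : 2 * (c + u%:Z + S) + j.+1%:Z = (2 * S + j%:Z) + 2 * c + 2 * u%:Z + 1 by lia.
by rewrite E; lia.
Qed.

Lemma card_int_interval (lo hi : int) : lo <= hi ->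
  (#|` int_interval lo hi|)%:Z = hi - lo + 1.
Proof.
move=> lohi; have -> : int_interval lo hi = progression lo 1 (absz (hi - lo + 1)).
  apply/fsetP=> x; rewrite in_int_interval.
  apply/idP/progressionP => [xin|[t tn ->]]; last by lia.
  by exists (absz (x - lo)); lia.
by rewrite card_progression //; lia.
Qed.

(* [x] is obtained by taking 2, 1, 0, 0, 0 of the two lowest terms, 0, 0, 0, 1, 2
   of the two highest ones, and all others from the run of consecutive integers
   in the middle; the five intervals of sums so obtained overlap. *)
Lemma rsum_full (a : nat -> int) (j M : nat) (x : int) :
    (2 <= j)%N -> (3 * j + 5 <= M)%N ->
    (forall t, (t < M)%N -> a (t + 2)%N = a 2%N + t%:Z) -> increasing a ->
    a 2%N - a 1%N <= (M - j)%N%:Z -> a 2%N - a 0%N <= (2 * (M - j) + 1)%N%:Z ->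
    a (M + 2)%N - a (M + 1)%N <= (M - j)%N%:Z ->
    a (M + 3)%N - a (M + 1)%N <= (2 * (M - j) + 1)%N%:Z ->
    2 * (a 0%N + a 1%N + j%:Z * a 2%N) + (j * j)%:Z <= 2 * x + j%:Z ->
    2 * x + (j * j)%:Z + j%:Z
      <= 2 * (a (M + 2)%N + a (M + 3)%N + j%:Z * a 2%N + (j * M)%:Z) ->
  x \in rsum a (j + 2) 0 (M + 4).
Proof.
move=> j2 jM lin inc f_le ef_le m_le gm_le lo hi.
have aM1 : a (M + 1)%N = a 2%N + (M - 1)%N%:Z.
  by rewrite -lin; [congr a|]; lia.
have mem pre post i (v : int) : sorted ltn pre -> all (fun t => t < 2)%N pre -> sorted ltn post ->
    all (fun t => M + 2 <= t < M + 4)%N post -> (size pre + i + size post = j + 2)%N ->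
    (i * i)%:Z <= 2 * v + i%:Z -> 2 * v + (i * i + i)%:Z <= 2 * (i * M)%:Z ->
    x = \sum_(t <- pre) a t + (i%:Z * a 2%N + v) + \sum_(t <- post) a t ->
    x \in rsum a (j + 2) 0 (M + 4).
  move=> srt_pre lt_pre srt_post in_post sz vlo vhi ->.
  have [s [srt szs sub <-]] := sum_of_middle_terms lin vlo vhi.
  apply/rsumP=> //; exists ((pre ++ s) ++ post); split.
  - rewrite sorted_pairwise; last exact: ltn_trans.
    rewrite !pairwise_cat -!(sorted_pairwise ltn_trans) srt_pre srt srt_post !andbT.
    apply/andP; split; apply/allrelP=> y z.
      rewrite mem_cat => /orP[/(allP lt_pre)|/sub] + /(allP in_post) /=;
        rewrite ?mem_iota; lia.
    by move=> /(allP lt_pre) /= + /sub; rewrite mem_iota; lia.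
  - by rewrite !size_cat szs.
  - move=> y; rewrite !mem_cat mem_iota => /orP[/orP[/(allP lt_pre)|/sub]|/(allP in_post)] /=;
      rewrite ?mem_iota; lia.
  - by rewrite !big_cat.
(* [slack1] makes the first two and the last two of the five intervals meet, [slack2] the middle one
   and its neighbours. *)
have slack1 : (j * j + j + (M - j) <= j * M)%N by nia.
have slack2 : (2 * M + 2 * j + 5 + 2 * (j * j) <= 2 * (j * M))%N by nia.
move: slack1 slack2 lo hi mem; set S := rsum _ _ _ _ => slack1 slack2 lo hi mem.
pose v1 := x - (a 0%N + a 1%N + j%:Z * a 2%N).
(* Each test asks whether [x] is at most the top of the current interval; if it is not, the slack
   puts [x] at or above the bottom of the next one. *)
have [le1|lt1] := leP (2 * v1 + (j * j + j)%:Z) (2 * (j * M)%:Z).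
  apply: (mem [:: 0%N; 1%N] [::] j v1) => //=; try by rewrite /v1; lia.
  by rewrite !big_cons !big_nil /v1; ring.
pose v2 := x - (a 0%N + (j + 1)%N%:Z * a 2%N).
have [le2|lt2] := leP (2 * v2 + ((j + 1) * (j + 1) + (j + 1))%:Z) (2 * ((j + 1) * M)%:Z).
  apply: (mem [:: 0%N] [::] (j + 1)%N v2) => //=; try by rewrite /v2 /v1 in lt1 *; lia.
  by rewrite !big_cons !big_nil /v2; ring.
pose v3 := x - (j + 2)%N%:Z * a 2%N.
have [le3|lt3] := leP (2 * v3 + ((j + 2) * (j + 2) + (j + 2))%:Z) (2 * ((j + 2) * M)%:Z).
  apply: (mem [::] [::] (j + 2)%N v3) => //=; try by rewrite /v3 /v2 in lt2 *; lia.
  by rewrite !big_nil /v3; ring.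
pose v4 := x - (a (M + 3)%N + (j + 1)%N%:Z * a 2%N).
have [le4|lt4] := leP (2 * v4 + ((j + 1) * (j + 1) + (j + 1))%:Z) (2 * ((j + 1) * M)%:Z).
  apply: (mem [::] [:: (M + 3)%N] (j + 1)%N v4) => //=; try by rewrite /v4 /v3 in lt3 *; lia.
  by rewrite !big_cons !big_nil /v4; ring.
pose v5 := x - (a (M + 2)%N + a (M + 3)%N + j%:Z * a 2%N).
apply: (mem [::] [:: (M + 2)%N; (M + 3)%N] j v5) => //=; try by rewrite /v5 /v4 in lt4 *; lia.
by rewrite !big_cons !big_nil /v5; ring.
Qed.

(** By [rsum_full] every integer between the least and the greatest sum occurs, so the size is their
    difference plus 1. The [j] middle terms contribute [j * (M - j)] to it, each index being shifted
    by [M - j]. *)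
Lemma card_rsum_full (a : nat -> int) (j M : nat) :
    (2 <= j)%N -> (3 * j + 5 <= M)%N ->
    (forall t, (t < M)%N -> a (t + 2)%N = a 2%N + t%:Z) -> increasing a ->
    a 2%N - a 1%N <= (M - j)%N%:Z -> a 2%N - a 0%N <= (2 * (M - j) + 1)%N%:Z ->
    a (M + 2)%N - a (M + 1)%N <= (M - j)%N%:Z ->
    a (M + 3)%N - a (M + 1)%N <= (2 * (M - j) + 1)%N%:Z ->
  (#|` rsum a (j + 2) 0 (M + 4)|)%:Z
    = a (M + 2)%N + a (M + 3)%N - a 0%N - a 1%N + (j * (M - j))%:Z + 1.
Proof.
move=> j2 jM lin inc f_le ef_le m_le gm_le.
pose lo : int := \sum_(i <- iota 0 (j + 2)) a i.
pose hi : int := \sum_(i <- iota (M - j + 2) (j + 2)) a i.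
have loE : 2 * lo + j%:Z = 2 * (a 0%N + a 1%N + j%:Z * a 2%N) + (j * j)%:Z.
  have jM' : (0 + j <= M)%N by lia.
  have := sum_iota_middle lin jM'; rewrite /lo (addn2 j) /= add0n !big_cons; lia.
have hiE : 2 * hi + j%:Z = 2 * (a (M + 2)%N + a (M + 3)%N + j%:Z * a 2%N)
                         + (2 * (j * (M - j)) + j * j)%:Z.
  have jM' : (M - j + j <= M)%N by lia.
  have := sum_iota_middle lin jM'.
  rewrite /hi iotaD big_cat /= !big_cons big_nil.
  have -> : (M - j + 2 + j = M + 2)%N by lia.
  have -> : (M + 2).+1 = (M + 3)%N by lia.
  by rewrite addr0; set S := \sum_(i <- _) _; lia.
have a01 : a 0%N + a 1%N < a (M + 2)%N + a (M + 3)%N by apply: ltrD; apply: inc; lia.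
have jMj : (j * M)%:Z = (j * (M - j))%:Z + (j * j)%:Z by rewrite -PoszD -mulnDr subnK; lia.
have -> : rsum a (j + 2) 0 (M + 4) = int_interval lo hi.
  apply/fsetP=> x; rewrite in_int_interval; apply/idP/andP => [xS|[xlo xhi]].
    split; first exact: rsum_ge xS.
    have -> : hi = \sum_(i <- iota (0 + (M - j + 2)) (j + 2)) a i by [].
    by apply: (@rsum_le a _ 0) => //; move: xS; congr (x \in rsum a _ _ _); lia.
  by apply: rsum_full => //; lia.
set r := (j * (M - j))%N in hiE *; rewrite card_int_interval; lia.
Qed.

(** * Enumeration of the set and conclusion *)

Lemma increasing_enum (A : {fset int}) :
  exists2 a, increasing a & A = [fset a i | i in iota 0 #|` A|].
Proof.
pose s := sort <=%R A; pose k := size s.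
have sk : #|` A| = k by rewrite /k size_sort.
have srt : sorted <%R s by rewrite sort_lt_sorted fset_uniq.
(* Past the end, the sequence goes on above the largest element, so that it increases on all
   naturals; for empty [A] the default 0 of [nth] serves as base. *)
exists (fun i => if (i < k)%N then nth 0 s i else nth 0 s k.-1 + i.+1%:Z).
  move=> i j ij; case: (ltnP j k) => jk.
    have ik := ltn_trans ij jk; rewrite ik.
    by rewrite (sorted_ltn_nth lt_trans) // inE.
  case: (ltnP i k) => ik; last by lia.
  suff : nth 0 s i <= nth 0 s k.-1 by lia.
  have srt' : sorted <=%R s by apply: sub_sorted srt => x y; exact: ltW.
  have k0 : (0 < k)%N by lia.
  by apply: (sorted_leq_nth le_trans lexx 0 srt'); rewrite ?inE -?/k; lia.
apply/fsetP=> x; rewrite -(mem_sort <=%R) -/s; apply/idP/imfsetP => [xs|[i /=]].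
  exists (index x s); rewrite ?nth_index ?index_mem ?xs //= mem_iota.
  by rewrite sk index_mem.
by rewrite mem_iota sk add0n => /= ik ->; rewrite ik mem_nth.
Qed.

Lemma dvdz_gcd_fset (d : int) (A : {fset int}) :
  {in A, forall x, (d %| x)%Z} -> (d %| gcd_fset A)%Z.
Proof.
move=> dA; rewrite /gcd_fset big_seq; elim/big_ind: _ => [|x y dx dy|x /dA //].
  exact: dvdz0.
by rewrite dvdz_gcd dx dy.
Qed.

Theorem theorem1p12 (h k : nat) (hh : (4 <= h)%N) (hk : (3 * h + 3 <= k)%N)
    (A : {fset int}) (cardA : #|` A| = k) (minA : is_min A 0)
    (gcdA : gcd_fset A = 1)
    (cardhA : (#|` restricted_sumset h A|)%:Z
              = h%:Z * k%:Z - h%:Z ^+ 2 + 3) :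
  exists x y : int,
    A = int_interval 0 (k%:Z + 1) `\` [fset x; y] /\
    [fset x; y] \in [:: [fset 1; 2];
                        [fset k%:Z - 1; k%:Z];
                        [fset 1; k%:Z];
                        [fset 2; k%:Z + 1];
                        [fset k%:Z - 2; k%:Z + 1]].
Proof.
have [a inc] := increasing_enum A; rewrite cardA => defA.
have memA z : reflect (exists2 i, (i < k)%N & z = a i) (z \in A).
  by rewrite defA; apply: (iffP (imfsetP _ _ _ _)) => -[i /= ik ->]; exists i;
    rewrite // mem_iota in ik *.
have a0 : a 0%N = 0.
  case: minA => /memA[i ik a0i] /(_ (a 0%N)) /(_ ltac:(by apply/memA; exists 0%N; lia)).
  case: i ik a0i => [//|i] _ a0i; have := inc 0%N i.+1 isT; lia.
pose w := (k - h)%N; have kE : k = (w + h)%N by rewrite /w; lia.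
have hw : (2 * h + 3 <= w)%N by lia.
have sumE : restricted_sumset h A = rsum a h 0 (w + h) by rewrite /rsum -kE -defA.
rewrite sumE in cardhA.
have cardE : #|` rsum a h 0 (w + h)| = (h * w + 3)%N.
  by move: cardhA; rewrite kE expr2; nia.
have [|d [e [f [m [g [d0 lin [ae af am ag] [ew fw] [gw mw]]]]]]] :=
  @rsum_small_structure a h w inc hh hw; first by rewrite cardE.
have idx i : (i < k)%N -> [\/ i = 0%N \/ i = 1%N, i = (w + h - 2)%N, i = (w + h - 1)%N |
                             exists2 t, (t + 5 <= w + h)%N & i = (t + 2)%N].
  move=> ik; have [i2|i2] := leqP i 1.
    by apply: Or41; case: i i2 {ik} => [|[|]] //; [left|right].
  have [ik2|ik2] := eqVneq i (w + h - 2)%N; first exact: Or42.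
  have [ik1|ik1] := eqVneq i (w + h - 1)%N; first exact: Or43.
  by apply: Or44; exists (i - 2)%N; lia.
have d1 : d = 1.
  (* As [a 0 = 0] and all gaps are multiples of [d], so are all elements. *)
  suff : (d %| gcd_fset A)%Z by rewrite gcdA dvdz1; lia.
  apply: dvdz_gcd_fset => _ /memA[i ik ->].
  have da1 : (d %| a 1%N)%Z by rewrite -[a 1%N]subr0 -a0 ae dvdz_mulr.
  have da2 : (d %| a 2%N)%Z by rewrite -[a 2%N](subrK (a 1%N)) af rpredD ?dvdz_mulr.
  have dam t : (t + 5 <= w + h)%N -> (d %| a (t + 2)%N)%Z.
    by move=> tk; rewrite lin // rpredD ?dvdz_mulr.
  have kE3 : (w + h - 3 = (w + h - 5) + 2)%N by clear -hw hh; lia.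
  have da3 : (d %| a (w + h - 3)%N)%Z by rewrite kE3; apply: dam; clear -hw hh; lia.
  have db1 : (d %| a (w + h - 2)%N)%Z.
    by rewrite -[a (w + h - 2)%N](subrK (a (w + h - 3)%N)) am rpredD ?dvdz_mulr.
  have db2 : (d %| a (w + h - 1)%N)%Z.
    by rewrite -[a (w + h - 1)%N](subrK (a (w + h - 2)%N)) ag rpredD ?dvdz_mulr.
  by case: (idx i ik) => [[]->|->|->|[t /dam ? ->]]; rewrite ?a0 ?dvdz0.
move: lin ae af am ag; rewrite {}d1 !mul1r a0 => lin ae af am ag {d d0}.
have := inc 0%N 1%N isT; have := inc 1%N 2%N isT.
have := inc (w + h - 3)%N (w + h - 2)%N; have := inc (w + h - 2)%N (w + h - 1)%N.
move=> /(_ ltac:(lia)) g0 /(_ ltac:(lia)) m0 f0 e0.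
pose M := (w + h - 4)%N; pose j := (h - 2)%N.
have linM t : (t < M)%N -> a (t + 2)%N = a 2%N + t%:Z.
  by move=> tM; rewrite lin ?mul1r //; rewrite /M in tM; lia.
have M1 : (M + 1 = w + h - 3)%N by rewrite /M; lia.
have M2 : (M + 2 = w + h - 2)%N by rewrite /M; lia.
have M3 : (M + 3 = w + h - 1)%N by rewrite /M; lia.
have aM1 : a (w + h - 3)%N = a 2%N + (M - 1)%N%:Z.
  by rewrite -M1 -linM; [congr a|]; rewrite /M; lia.
(* The size given by [card_rsum_full] is [h * w - 5 + (e + 2 * f + 2 * m + g)], to be equated with
   [h * w + 3]. *)
have gaps : (e + 2 * f + 2 * m + g = 8)%N.
  have := @card_rsum_full a j M; rewrite M1 M2 M3.
  have -> : (j + 2 = h)%N by rewrite /j; lia.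
  have -> : (M + 4 = w + h)%N by rewrite /M; lia.
  rewrite cardE; have -> : (M - j = w - 2)%N by rewrite /M /j; lia.
  have -> : (j * (w - 2) = h * w - 2 * h - 2 * w + 4)%N by rewrite /j; nia.
  have hw2 : (2 * h + 2 * w <= h * w)%N by nia.
  by move=> /(_ ltac:(lia) ltac:(rewrite /M /j; lia) linM inc); rewrite a0; lia.
have memE z : (z \in A) = [|| z == 0, z == e%:Z,
    (e + f)%N%:Z <= z <= (e + f)%N%:Z + (M - 1)%N%:Z,
    z == (e + f + (M - 1) + m)%N%:Z | z == (e + f + (M - 1) + m + g)%N%:Z].
  apply/memA/idP => [[i ik ->]|].
    case: (idx i ik) => [[]->|->|->|[t tk ->]]; [by rewrite a0|lia|lia|lia|].
    by rewrite linM; rewrite /M; lia.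
  case/or4P=> [/eqP->|/eqP->|zc|/orP[]/eqP->].
  - by exists 0%N; [lia|rewrite a0].
  - by exists 1%N; lia.
  - exists (absz (z - (e + f)%N%:Z) + 2)%N; first by rewrite /M in zc; lia.
    by rewrite linM; rewrite /M in zc *; lia.
  - by exists (w + h - 2)%N; lia.
  - by exists (w + h - 1)%N; lia.
have ME : M%:Z = k%:Z - 4 by rewrite /M kE; lia.
have k15 : (15 <= k)%N by lia.
have {memA memE linM M1 M2 M3 aM1 lin} finish (x y : int) :
    (forall z : int, [|| z == 0, z == e%:Z,
      (e + f)%N%:Z <= z <= (e + f)%N%:Z + (M - 1)%N%:Z,
      z == (e + f + (M - 1) + m)%N%:Z | z == (e + f + (M - 1) + m + g)%N%:Z]
     = ~~ ((z == x) || (z == y)) && (0 <= z <= k%:Z + 1)) ->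
    A = int_interval 0 (k%:Z + 1) `\` [fset x; y].
  by move=> E; apply/fsetP=> z; rewrite inE !in_fset2 in_int_interval memE E.
(* All four gaps are positive, and ones give weight 6. The remaining 2 goes to [e], to [g], to both
   equally, or raises [f] or [m] by one. In the last two cases the maximum is [k], whence [k + 1]
   among the removed points. *)
have [[e1 f1 m1 g1]|[[e1 f1 m1 g1]|[[e1 f1 m1 g1]|[[e1 f1 m1 g1]|[e1 f1 m1 g1]]]]] :
    [/\ e = 3%N, f = 1%N, m = 1%N & g = 1%N] \/ [/\ e = 1%N, f = 1%N, m = 1%N & g = 3%N] \/
    [/\ e = 2%N, f = 1%N, m = 1%N & g = 2%N] \/ [/\ e = 1%N, f = 2%N, m = 1%N & g = 1%N] \/
    [/\ e = 1%N, f = 1%N, m = 2%N & g = 1%N].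
  have [e2|[e2|e2]] : e = 1%N \/ e = 2%N \/ e = 3%N by lia.
  - have [f2|f2] : f = 1%N \/ f = 2%N by lia.
      have [m2|m2] : m = 1%N \/ m = 2%N by lia.
        by right; left; split; lia.
      by do 4!right; split; lia.
    by do 3!right; left; split; lia.
  - by do 2!right; left; split; lia.
  - by left; split; lia.
- by exists 1, 2; split; [apply: finish => z; lia | rewrite !inE eqxx ?orbT].
- by exists (k%:Z - 1), k%:Z; split; [apply: finish => z; lia | rewrite !inE eqxx ?orbT].
- by exists 1, k%:Z; split; [apply: finish => z; lia | rewrite !inE eqxx ?orbT].
- by exists 2, (k%:Z + 1); split; [apply: finish => z; lia | rewrite !inE eqxx ?orbT].
- by exists (k%:Z - 2), (k%:Z + 1); split; [apply: finish => z; lia | rewrite !inE eqxx ?orbT].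
Qed.
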